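(* Let $\mathfrak{d}$ be a finite-dimensional real Lie algebra with an invariant non-degenerate symmetric bilinear form $\langle\,,\rangle$ of symmetric signature, let $V_+\subset\mathfrak{d}$ be a linear subspace with $\dim V_+=(\dim\mathfrak{d})/2$ such that $\langle\,,\rangle|_{V_+}$ is positive definite, and let $V_-:=(V_+)^\perp\subset\mathfrak{d}$. Let $\mathfrak{g}$ be a Lie algebra and let $p:\mathfrak{d}\to\mathfrak{g}$ be a linear map such that $$[p(X),p(Y)]=p([X,Y])\qquad\forall X\in V_+,\ Y\in V_-.$$ Let $\Sigma$ be the cylinder $S^1\times\mathbb{R}$ with the metric $d\sigma^2-d\tau^2$. If $A\in\Omega^1(\Sigma,\mathfrak{d})$ satisfies $$dA+[A,A]/2=0\qquad\text{and}\qquad A\in\Omega^{1,0}(\Sigma,V_+)\oplus\Omega^{0,1}(\Sigma,V_-),$$ then $p(A)\in\Omega^1(\Sigma,\mathfrak{g})$ is flat, i.e. $$d\,p(A)+[p(A),p(A)]/2=0.$$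
   Context: All objects are real and smooth, and Lie algebras are finite-dimensional. ''Symmetric signature'' means signature $(n,n)$ with $2n=\dim\mathfrak{d}$. The coordinates on $\Sigma=S^1\times\mathbb{R}$ are $\sigma\in S^1$ and $\tau\in\mathbb{R}$. The decomposition $\Omega^1(\Sigma)=\Omega^{1,0}(\Sigma)\oplus\Omega^{0,1}(\Sigma)$ is the splitting of 1-forms into the two light-cone (null) types: with $\sigma^\pm=\tau\pm\sigma$, $\Omega^{1,0}(\Sigma)$ consists of the forms $u\,d\sigma^+$ and $\Omega^{0,1}(\Sigma)$ of the forms $u\,d\sigma^-$, with $u$ a function on $\Sigma$. For a vector space $V$, $\Omega^{1,0}(\Sigma,V)$ and $\Omega^{0,1}(\Sigma,V)$ denote the $V$-valued forms of the given type. For a Lie algebra $\mathfrak{k}$ and $\alpha,\beta\in\Omega^1(\Sigma,\mathfrak{k})$, the 2-form $[\alpha,\beta]\in\Omega^2(\Sigma,\mathfrak{k})$ combines the wedge product with the Lie bracket: $[\alpha,\beta](u,v)=[\alpha(u),\beta(v)]-[\alpha(v),\beta(u)]$; thus $([\alpha,\alpha]/2)(u,v)=[\alpha(u),\alpha(v)]$. The form $p(A)$ is obtained by applying the linear map $p$ to the values of $A$. *)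

(* Defs.v *)
From HB Require Import structures.
From mathcomp Require Import all_boot all_order all_algebra.
From mathcomp Require Import sesquilinear.
From mathcomp Require Import all_classical all_reals all_analysis.

Set Implicit Arguments.
Unset Strict Implicit.
Unset Printing Implicit Defensive.

Import Order.TTheory GRing.Theory Num.Theory.
Import numFieldNormedType.Exports.

Local Open Scope ring_scope.

HB.mixin Record isLieAlgebra (R : fieldType) L of Vector R L := {
  lie : L -> L -> L;
  lie_linearl : forall y, linear (lie ^~ y);
  lie_linearr : forall x, linear (lie x);
  lie_alt : forall x, lie x x = 0;
  lie_jacobi : forall x y z,
    lie x (lie y z) + lie y (lie z x) + lie z (lie x y) = 0
}.

#[short(type="lieAlgType")]
HB.structure Definition LieAlgebra (R : fieldType) :=
  { L of isLieAlgebra R L & Vector R L }.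

Section Forms.
Variable R : realType.

Definition invariant_form (d : lieAlgType R) (B : d -> d -> R) : Prop :=
  forall x y z, B (lie x y) z = B x (lie y z).

Definition has_signature (V : vectType R) (B : {symmetric V}) (p q : nat) :=
  exists (e : p.-tuple V) (f : q.-tuple V),
    [/\ basis_of fullv (e ++ f), pairwise_orthogonal B (e ++ f),
        {in e, forall v, 0 < B v v} & {in f, forall v, B v v < 0}].

Definition symmetric_signature (V : vectType R) (B : {symmetric V}) :=
  exists2 n, n.*2 = \dim {:V} & has_signature B n n.

Definition positive_definite_on (V : vectType R) (B : {symmetric V})
    (W : {vspace V}) :=
  forall v, v \in W -> v != 0 -> 0 < B v v.

End Forms.

Section Smooth.
Variable R : realType.

Fixpoint Ck (k : nat) (E F : normedModType R) (f : E -> F) : Prop :=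
  match k with
  | 0 => continuous f
  | k'.+1 => (forall x, differentiable f x) /\
             (forall u, Ck k' (fun x => 'D_u f x))
  end.

(* A vectType carries no topology: calculus for functions valued in V is done
   in coordinates, all choices of basis being equivalent. *)
Definition smooth (E : normedModType R) (V : vectType R) (f : E -> V) : Prop :=
  forall k, Ck k (passmx.rVof (vbasis {:V}) \o f).

Definition dir_derive (E : normedModType R) (V : vectType R) (u : E)
    (f : E -> V) (x : E) : V :=
  passmx.vecof (vbasis {:V}) ('D_u (passmx.rVof (vbasis {:V}) \o f) x).

End Smooth.

(* The cylinder S^1 x R is the quotient of the plane with coordinates
   (sigma, tau) by the translation (sigma, tau) |-> (sigma + 2 pi, tau).
   Functions and forms on it are represented by their pullbacks to the plane,
   that is, by the functions and forms invariant under this translation. *)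
Section Cylinder.
Variable R : realType.

Local Notation plane := 'rV[R]_2.

Definition sigma (x : plane) : R := x 0 0.
Definition tau (x : plane) : R := x 0 1.

(* d sigma ^ 2 - d tau ^ 2 = - (d sigma_plus) (d sigma_minus) *)
Definition sigma_plus (x : plane) : R := tau x + sigma x.
Definition sigma_minus (x : plane) : R := tau x - sigma x.

Definition deck : plane := (pi *+ 2) *: delta_mx 0 0.

Definition form1 (V : vectType R) := plane -> 'Hom(plane, V).
Definition form2 (V : vectType R) := plane -> plane -> plane -> V.

Definition Omega0 (V : vectType R) (W : {vspace V}) : set (plane -> V) :=
  [set f | [/\ smooth f, periodic f deck & forall x, f x \in W]].

Definition Omega1 (V : vectType R) : set (form1 V) :=
  [set A : form1 V | (forall w, smooth (fun x => A x w)) /\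
                     periodic A deck].

Definition Omega10 (V : vectType R) (W : {vspace V}) : set (form1 V) :=
  [set A : form1 V | exists2 f, Omega0 W f &
     forall x w, A x w = ('d sigma_plus x w : R) *: f x].

Definition Omega01 (V : vectType R) (W : {vspace V}) : set (form1 V) :=
  [set A : form1 V | exists2 f, Omega0 W f &
     forall x w, A x w = ('d sigma_minus x w : R) *: f x].

(* The tangent vectors u and v extend to constant, hence commuting, vector
   fields, so the term A([u, v]) of the exterior derivative vanishes. *)
Definition ext_derive (V : vectType R) (A : form1 V) : form2 V :=
  fun x u v =>
    dir_derive u (fun y => A y v) x - dir_derive v (fun y => A y u) x.

Definition lie_wedge (k : lieAlgType R) (A B : form1 k) : form2 k :=
  fun x u v => lie (A x u) (B x v) - lie (A x v) (B x u).

Definition flat (k : lieAlgType R) (A : form1 k) : Prop :=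
  forall x u v, ext_derive A x u v + 2^-1 *: lie_wedge A A x u v = 0.

Definition map_form (V W : vectType R) (p : 'Hom(V, W)) (A : form1 V) :
  form1 W := fun x => (p \o A x)%VF.

End Cylinder.

(* Main.v *)
(* Write A = f dsigma^+ + h dsigma^- with f in V_+ and h in V_-. The diagonal
   terms of [A, A] vanish because the bracket is alternating, so only multiples
   of [f, h] survive, and p preserves that bracket; as p is linear with constant
   coefficients it also commutes with d. Hence the curvature of p(A) is the
   image under p of the curvature of A. *)
From HB Require Import structures.
Require Import Defs.
From mathcomp Require Import all_boot all_order all_algebra.
From mathcomp Require Import sesquilinear.
From mathcomp Require Import all_classical all_reals all_analysis.

Set Implicit Arguments.
Unset Strict Implicit.
Unset Printing Implicit Defensive.

Import GRing.Theory Num.Theory numFieldNormedType.Exports.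

Local Open Scope ring_scope.

Section ConstantLinearImage.
Variables (R : realType) (E : normedModType R).

(** The product is the sum of the rows of [M] weighted by the coordinates of [v], and coordinates
    are continuous. Continuity is what makes this linear map differentiable and equal to its own
    differential. *)
Lemma mulmxr_continuous m n (M : 'M[R]_(m, n)) :
  continuous (fun v : 'rV[R]_m => v *m M).
Proof.
under eq_fun do rewrite mulmx_sum_row.
apply: continuous_big => [|i _ v]; first exact: add_continuous.
apply: (@cvgZr_tmp _ _ _ (nbhs v)); exact: coord_continuous.
Qed.

Section Coordinates.
Variables (m n : nat) (M : 'M[R]_(m, n)) (f : E -> 'rV[R]_m).

Lemma differentiable_mulmxr x :
  differentiable f x -> differentiable (fun y => f y *m M) x.
Proof.
move=> df; apply: (@differentiable_comp _ _ _ _ f (mulmxr M)) => //.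
exact/linear_differentiable/mulmxr_continuous.
Qed.

Lemma derive_mulmxr u x :
  differentiable f x -> 'D_u (fun y => f y *m M) x = 'D_u f x *m M.
Proof.
move=> df; rewrite !deriveE //; last exact: differentiable_mulmxr.
have cM := @mulmxr_continuous m n M.
rewrite (@diff_comp _ _ _ _ f (mulmxr M)) //=.
  by rewrite (@diff_lin _ _ _ (mulmxr M)).
exact/linear_differentiable.
Qed.

End Coordinates.

Lemma Ck_mulmxr m n (M : 'M[R]_(m, n)) k (f : E -> 'rV[R]_m) :
  Ck k f -> Ck k (fun y => f y *m M).
Proof.
elim: k f => [|k IHk] f /=.
  move=> cf x; apply: (@continuous_comp _ _ _ f (mulmxr M)); first exact: cf.
  exact: mulmxr_continuous.
move=> [df Df]; split=> [x|u]; first exact: differentiable_mulmxr.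
(* Differentiation commutes with the constant matrix, so the induction hypothesis applies to
   ['D_u f] in place of [f]. *)
under eq_fun do rewrite derive_mulmxr //.
exact: IHk.
Qed.

Variables (V W : vectType R) (p : 'Hom(V, W)) (f : E -> V).

(** In coordinates [p] is right multiplication by a constant matrix; this carries the matrix lemmas
    over to [smooth] and [dir_derive]. *)
Lemma rVof_hom_comp :
  passmx.rVof (vbasis {:W}) \o (p \o f) =
  fun x => (passmx.rVof (vbasis {:V}) \o f) x *m
             passmx.mxof (vbasis {:V}) (vbasis {:W}) p.
Proof. by apply/funext => x /=; rewrite (passmx.rVof_app _ (vbasisP fullv)). Qed.

Lemma smooth_hom : smooth f -> smooth (p \o f).
Proof. by move=> sf k; rewrite rVof_hom_comp; apply: Ck_mulmxr. Qed.

Lemma dir_derive_hom u x :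
  smooth f -> dir_derive u (p \o f) x = p (dir_derive u f x).
Proof.
(* The case [k = 1] of smoothness supplies differentiability of the coordinates. *)
move=> /(_ 1)[df _].
rewrite /dir_derive rVof_hom_comp derive_mulmxr //.
by rewrite -passmx.hom_vecof ?vbasisP.
Qed.

End ConstantLinearImage.

Section LieForms.
Variables (R : realType).

HB.instance Definition _ (k : lieAlgType R) (x : k) :=
  GRing.isLinear.Build R k k *:%R (lie x) (lie_linearr x).

Lemma lieDl (k : lieAlgType R) (x y z : k) :
  lie (x + y) z = lie x z + lie y z.
Proof. by have := lie_linearl z 1 x y; rewrite !scale1r. Qed.

Lemma lieZl (k : lieAlgType R) a (x z : k) :
  lie (a *: x) z = a *: lie x z.
Proof.
have lie0l : lie 0 z = 0 by apply: (addrI (lie 0 z)); rewrite -lieDl !addr0.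
by have := lie_linearl z a x 0; rewrite lie0l !addr0.
Qed.

Lemma lieC (k : lieAlgType R) (x y : k) : lie x y = - lie y x.
Proof.
have := lie_alt (x + y).
by rewrite lieDl !linearD /= !lie_alt add0r addr0 => /eqP; rewrite addr_eq0 => /eqP.
Qed.

(** By antisymmetry the two terms of the wedge add up to twice one bracket, and the factor 1/2
    cancels. *)
Lemma lie_wedgeE (k : lieAlgType R) (A : form1 k) x u v :
  2^-1 *: lie_wedge A A x u v = lie (A x u) (A x v).
Proof.
rewrite /lie_wedge (lieC (A x v)) opprK -mulr2n -(scaler_nat 2 (lie _ _)).
by rewrite scalerA mulVf ?scale1r // pnatr_eq0.
Qed.

(** The scalar is a 2 by 2 determinant: for the coefficients used below, it is the value of the
    2-form $d\sigma^+\wedge d\sigma^-$ on the two tangent vectors. *)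
Lemma lie_combination (k : lieAlgType R) (a b a' b' : R) (X Y : k) :
  lie (a *: X + b *: Y) (a' *: X + b' *: Y) = (a * b' - b * a') *: lie X Y.
Proof.
rewrite lieDl !linearD /= !linearZ /= !lieZl !lie_alt !scaler0 add0r addr0.
by rewrite (lieC Y) !scalerN !scalerA scalerBl (mulrC b') (mulrC a').
Qed.

Lemma ext_derive_hom (V W : vectType R) (p : 'Hom(V, W)) (A : form1 V) x u v :
  Omega1 A -> ext_derive (map_form p A) x u v = p (ext_derive A x u v).
Proof.
move=> [sA _]; have pA w : (fun y => map_form p A y w) = p \o (A ^~ w).
  by apply/funext => y; rewrite /map_form comp_lfunE.
by rewrite /ext_derive !pA !dir_derive_hom // linearB.
Qed.

Lemma Omega1_hom (V W : vectType R) (p : 'Hom(V, W)) (A : form1 V) :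
  Omega1 A -> Omega1 (map_form p A).
Proof.
move=> [sA perA]; split=> [w|x]; last by rewrite /map_form perA.
rewrite (_ : (fun y => _) = p \o (A ^~ w)); first exact: smooth_hom.
by apply/funext => y; rewrite /map_form comp_lfunE.
Qed.

End LieForms.

Theorem proposition1 (R : realType) (d : lieAlgType R) (form : {symmetric d})
    (form_inv : invariant_form form)
    (form_nondeg : nondegenerate form)
    (form_sign : symmetric_signature form)
    (Vp : {vspace d})
    (dim_Vp : (\dim Vp).*2 = \dim {:d})
    (Vp_pos : positive_definite_on form Vp)
    (g : lieAlgType R) (p : 'Hom(d, g))
    (p_lie : forall X Y, X \in Vp -> Y \in orthov form Vp ->
       lie (p X) (p Y) = p (lie X Y))
    (A : form1 d)
    (A_form : Omega1 A)
    (A_flat : flat A)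
    (A_type : exists B C : form1 d,
       [/\ Omega10 Vp B, Omega01 (orthov form Vp) C &
           forall x, A x = B x + C x]) :
  Omega1 (map_form p A) /\ flat (map_form p A).
Proof.
split=> [|x u v]; first exact: Omega1_hom.
have [B [C [[f [_ _ fVp] Bf] [h [_ _ hVm] Ch] ABC]]] := A_type.
have AE w : A x w =
    ('d (@sigma_plus R) x w : R) *: f x + ('d (@sigma_minus R) x w : R) *: h x.
  by rewrite ABC add_lfunE Bf Ch.
(* No full homomorphism property is available: both sides become the same multiple of a bracket of
   [f x] in [Vp] with [h x] in its orthogonal, where [p_lie] applies. *)
have p_bracket : lie (p (A x u)) (p (A x v)) = p (lie (A x u) (A x v)).
  have pAE w : p (A x w) =
      ('d (@sigma_plus R) x w : R) *: p (f x) +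
      ('d (@sigma_minus R) x w : R) *: p (h x).
    by rewrite AE linearD !linearZ.
  by rewrite !pAE !AE !lie_combination [RHS]linearZ /= p_lie.
have := congr1 p (A_flat x u v).
rewrite ext_derive_hom // !lie_wedgeE /map_form !comp_lfunE p_bracket.
by rewrite linearD linear0.
Qed.
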